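(* If $g\in GL(2,\mathcal{O}_{-3})$ is of finite order $r$ and $\det(g)=e^{\frac{\pi i}{3}}$, then $$r=6\quad\text{and}\quad\mathrm{tr}(g)\in\left\{0,\pm\left(\tfrac32+\tfrac{\sqrt{-3}}{2}\right)\right\}.$$ More precisely, for the eigenvalues $\lambda_1,\lambda_2$ of $g$ (up to a transposition): (i) $\mathrm{tr}(g)=0$ exactly when $\lambda_1=e^{\frac{2\pi i}{3}}$, $\lambda_2=e^{-\frac{\pi i}{3}}$; (ii) $\mathrm{tr}(g)=\frac32+\frac{\sqrt{-3}}{2}$ exactly when $\lambda_1=e^{\frac{\pi i}{3}}$, $\lambda_2=1$; (iii) $\mathrm{tr}(g)=-\frac32-\frac{\sqrt{-3}}{2}$ exactly when $\lambda_1=e^{-\frac{2\pi i}{3}}$, $\lambda_2=-1$.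
   Context: $\mathcal{O}_{-3}=\mathbb{Z}+\frac{1+\sqrt{-3}}{2}\mathbb{Z}$ is the ring of the Eisenstein integers, $\sqrt{-3}=i\sqrt3$, and $GL(2,\mathcal{O}_{-3})$ is the group of $2\times2$ matrices over $\mathcal{O}_{-3}$ with determinant in $\mathcal{O}_{-3}^*=\langle e^{\frac{\pi i}{3}}\rangle$. *)

(* Defs.v *)
From HB Require Import structures.
From mathcomp Require Import all_boot all_order all_algebra.
From mathcomp Require Import complex.
From mathcomp Require Import all_classical all_reals all_analysis.

Set Implicit Arguments.
Unset Strict Implicit.
Unset Printing Implicit Defensive.

Import Order.TTheory GRing.Theory Num.Theory.
Local Open Scope ring_scope.
Local Open Scope complex_scope.

(* e^(i t) for real t, by Euler's formula *)
Definition expi (R : realType) (t : R) : R[i] := cos t +i* sin t.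

Definition sqrtm3 (R : realType) : R[i] := 0 +i* Num.sqrt 3.

(* O_{-3} = Z + ((1 + sqrt(-3)) / 2) Z as a subset of R[i] *)
Definition eisenstein (R : realType) (z : R[i]) : Prop :=
  exists a b : int, z = a%:~R + (1 + sqrtm3 R) / 2 * b%:~R.

(* The group of units of O_{-3}: the inverse must lie in O_{-3}, not merely in
   R[i]. *)
Definition eisenstein_unit (R : realType) (z : R[i]) : Prop :=
  eisenstein z /\ exists2 w : R[i], eisenstein w & z * w = 1.

Definition GL2_eisenstein (R : realType) (g : 'M[R[i]]_2) : Prop :=
  (forall i j, eisenstein (g i j)) /\ eisenstein_unit (\det g).

Definition has_order (R : realType) (g : 'M[R[i]]_2) (r : nat) : Prop :=
  [/\ (0 < r)%N, g ^+ r = 1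
    & forall k : nat, (0 < k)%N -> g ^+ k = 1 -> (r <= k)%N].

(* l1, l2 are the eigenvalues of g, listed with algebraic multiplicity.  As
   R[i] is algebraically closed, such l1 and l2 always exist. *)
Definition eigenvalues (R : realType) (g : 'M[R[i]]_2) (l1 l2 : R[i]) : Prop :=
  char_poly g = ('X - l1%:P) * ('X - l2%:P).

Definition eq_up_to_swap (T : Type) (x1 x2 y1 y2 : T) : Prop :=
  (x1 = y1 /\ x2 = y2) \/ (x1 = y2 /\ x2 = y1).

(* Main.v *)
Require Import Defs.
From HB Require Import structures.
From mathcomp Require Import all_boot all_order all_algebra.
From mathcomp Require Import complex zify ring lra.
From mathcomp Require Import all_classical all_reals all_analysis.

Set Implicit Arguments.
Unset Strict Implicit.
Unset Printing Implicit Defensive.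

Import Order.TTheory GRing.Theory Num.Theory.
Local Open Scope ring_scope.
Local Open Scope complex_scope.

(** Write [z = exp(i pi / 3)], a primitive sixth root of unity with
    [z ^ 2 = z - 1], so that the Eisenstein integers are the [a + b z].

    The eigenvalues of a matrix of finite order are roots of unity, hence
    have modulus one, and their product is [det g = z].  Conjugation inverts
    them, so the trace [t] satisfies [t = z * conj t]: it lies on a fixed real
    line through the origin, and the Eisenstein integers on that line are the
    [a (1 + z)] with [a] an integer.  Being a sum of two numbers of modulus
    one, [t] also satisfies [3 a ^ 2 = |t| ^ 2 <= 4], which leaves
    [a = 0, 1, -1] ([eisenstein_trace_of_unimodular]).

    In the three cases [t = 0] or [t ^ 2 = 3 z], and then the characteristic
    polynomial [X ^ 2 - t X + z] divides [X ^ 6 - 1]; Cayley-Hamilton gives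
    [g ^ 6 = 1] ([mx2_exp6]).  Conversely [g ^ r = 1] forces [z ^ r = 1] by
    taking determinants, so [6] divides [r].

    Finally, as the product of the eigenvalues is known to be [z], prescribing
    their sum amounts to prescribing them up to order
    ([eq_up_to_swap_sum]). *)

(** * Matrices of size two *)

Lemma char_poly_mx2 (R : comNzRingType) (g : 'M[R]_2) :
  char_poly g = 'X^2 - (\tr g)%:P * 'X + (\det g)%:P.
Proof.
have := char_poly_monic g; rewrite monicE lead_coefE size_char_poly /= => /eqP h2.
have h1 := char_poly_trace g (isT : (0 < 2)%N); rewrite /= in h1.
have h0 := char_poly_det g; rewrite sqrrN expr1n mul1r in h0.
have h3 := size_char_poly g.
move: (char_poly g) h0 h1 h2 h3 => p h0 h1 h2 h3.
apply/polyP => -[|[|[|k]]]; rewrite !coefE /= ?h0 ?h1 ?h2; try ring.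
by rewrite nth_default ?h3 //; ring.
Qed.

Lemma eigenvalues_sum_prod (R : realType) (g : 'M[R[i]]_2) l1 l2 :
  eigenvalues g l1 l2 -> \tr g = l1 + l2 /\ \det g = l1 * l2.
Proof.
rewrite /eigenvalues char_poly_mx2 => /polyP E.
have := E 0%N; have := E 1%N.
have -> : ('X - l1%:P) * ('X - l2%:P) = 'X^2 - (l1 + l2)%:P * 'X + (l1 * l2)%:P.
  by rewrite rmorphD rmorphM /=; ring.
rewrite !coefE /= => e1 e0; split.
  by apply: oppr_inj; transitivity (0 - \tr g * 1 + 0); [ring | rewrite e1; ring].
by transitivity (0 - \tr g * 0 + \det g); [ring | rewrite e0; ring].
Qed.

Lemma eigenvalue_exp1 (F : fieldType) (n : nat) (g : 'M[F]_n.+1) (l : F) r :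
  eigenvalue g l -> g ^+ r = 1 -> l ^+ r = 1.
Proof.
move=> /eigenvalueP [v vg v0] gr.
have vgk k : v *m g ^+ k = l ^+ k *: v.
  elim: k => [|k IH]; first by rewrite !expr0 mulmx1 scale1r.
  by rewrite exprSr mulmxA IH -scalemxAl vg scalerA -exprSr.
have := vgk r; rewrite gr mulmx1 => /eqP; rewrite -subr_eq0 -{1}[v]scale1r.
by rewrite -scalerBl scaler_eq0 (negbTE v0) orbF subr_eq0 => /eqP.
Qed.

Lemma detX (R : comNzRingType) (n : nat) (g : 'M[R]_n.+1) k :
  \det (g ^+ k) = \det g ^+ k.
Proof.
elim: k => [|k IH]; first by rewrite !expr0 det1.
by rewrite !exprS det_mulmx IH.
Qed.

(** If [d ^ 3 = -1], then
    [X ^ 6 - 1 = X ^ 6 + d ^ 3 = (X ^ 2 + d) * ((X ^ 2 + d) ^ 2 - 3 d X ^ 2)].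
    The first factor is the characteristic polynomial when the trace [t]
    vanishes; when [t ^ 2 = 3 d] the second one is a difference of two squares
    with the characteristic polynomial [X ^ 2 - t X + d] as a factor. *)
Lemma mx2_exp6 (R : comNzRingType) (g : 'M[R]_2) :
  \tr g = 0 \/ \tr g ^+ 2 = 3 * \det g ->
  \det g ^+ 3 = -1 -> g ^+ 6 = 1.
Proof.
move=> ht hd; set t := \tr g in ht; set d := \det g in ht hd.
have hD : d%:P ^+ 3 = -1 :> {poly R} by rewrite -rmorphXn hd rmorphN1.
have E : 'X^6 - 1 = ('X^2 + d%:P) * (('X^2 + d%:P) ^+ 2 - (3 * d)%:P * 'X^2).
  by rewrite -[X in _ - X]opprK -hD rmorphM rmorph_nat; ring.
suff [q Eq] : exists q, 'X^6 - 1 = q * char_poly g.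
  apply/eqP; rewrite -subr_eq0; apply/eqP.
  have := congr1 (horner_mx g) Eq.
  rewrite rmorphM /= Cayley_Hamilton mulr0 rmorphB /= rmorphXn /=.
  by rewrite horner_mx_X rmorph1.
rewrite char_poly_mx2 -/t -/d; case: ht => ht.
  by exists (('X^2 + d%:P) ^+ 2 - (3 * d)%:P * 'X^2); rewrite E ht; ring.
by exists (('X^2 + d%:P) * ('X^2 + t%:P * 'X + d%:P)); rewrite E -ht rmorphXn; ring.
Qed.

(** * Sixth roots of unity and the possible traces *)

Lemma sixth_root_exp3 (R : comNzRingType) (z : R) : z ^+ 2 = z - 1 -> z ^+ 3 = -1.
Proof. by move=> hz; rewrite exprSr hz mulrBl -expr2 hz; ring. Qed.

Lemma sixth_root_primitive (F : numFieldType) (z : F) :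
  z ^+ 2 = z - 1 -> 6.-primitive_root z.
Proof.
move=> hz; have h3 := sixth_root_exp3 hz.
have h6 : z ^+ 6 = 1 by rewrite (exprM z 3 2) h3 sqrrN expr1n.
have [m hm m6] := prim_order_exists (isT : (0 < 6)%N) h6.
(* The order of z is a divisor of 6; the three proper ones contradict
   z ^ 2 = z - 1 since 2 and 3 are nonzero in F. *)
have : m \in divisors 6 by rewrite -dvdn_divisors.
have -> : divisors 6 = [:: 1; 2; 3; 6]%N by [].
rewrite !inE => /or4P [] /eqP mE; rewrite mE // in hm.
- move: (prim_expr_order hm) hz; rewrite expr1 => ->.
  by rewrite subrr expr1n => /eqP; rewrite oner_eq0.
- move: (prim_expr_order hm); rewrite hz => /eqP; rewrite subr_eq => /eqP z2.
  move: h3; rewrite z2 => /eqP; rewrite -subr_eq0.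
  by rewrite (_ : _ - _ = 9%:R) ?pnatr_eq0 //; ring.
- move: (prim_expr_order hm); rewrite h3 => /eqP; rewrite -subr_eq0.
  by rewrite (_ : _ - _ = - 2%:R) ?oppr_eq0 ?pnatr_eq0 //; ring.
Qed.

(** Since [l1] and [l2] have modulus one, [z * conj (l1 + l2) = l1 + l2], and
    [conj z = 1 - z].  On [a + b z] the map [t |-> z * conj t] exchanges [a] and
    [b], hence [a = b]; the bound [|l1 + l2| <= 2] then reads
    [3 a ^ 2 <= 4]. *)
Lemma eisenstein_trace_of_unimodular (C : numClosedFieldType) (z l1 l2 : C) (a b : int) :
  z ^+ 2 = z - 1 -> `|l1| = 1 -> `|l2| = 1 -> l1 * l2 = z ->
  l1 + l2 = a%:~R + z * b%:~R ->
  [\/ l1 + l2 = 0, l1 + l2 = 1 + z | l1 + l2 = - (1 + z)].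
Proof.
move=> hz n1 n2 hp hs.
have c1 : l1 * l1^* = 1 by rewrite -normCK n1 expr1n.
have c2 : l2 * l2^* = 1 by rewrite -normCK n2 expr1n.
have nz : z != 0.
  apply/eqP => z0; move: hz; rewrite z0 expr0n /= => /esym /eqP.
  by rewrite sub0r oppr_eq0 oner_eq0.
have czz : z * z^* = 1 by rewrite -hp rmorphM /= mulrACA c1 c2 mulr1.
have cz : (z^*)%R = 1 - z.
  by apply: (mulfI nz); rewrite czz mulrBr -expr2 hz; ring.
have hc : ((l1 + l2)^*)%R = a%:~R + (1 - z) * b%:~R.
  by rewrite hs rmorphD rmorphM /= cz !rmorph_int.
have hself : l1 + l2 = z * (l1 + l2)^*.
  rewrite rmorphD /= -hp.
  transitivity (l2 * (l1 * l1^*) + l1 * (l2 * l2^*)); last by ring.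
  by rewrite c1 c2; ring.
have zN1 : z != 1.
  by apply/eqP => z1; move: hz; rewrite z1 subrr expr1n => /eqP; rewrite oner_eq0.
have ab : a = b.
  apply/eqP; rewrite -(eqr_int C) -subr_eq0.
  have : (a%:~R - b%:~R) * (1 - z) = 0 :> C.
    move: hself; rewrite hc hs => /eqP; rewrite -subr_eq0 => /eqP <-.
    transitivity (a%:~R + z * b%:~R - z * a%:~R - (z - z ^+ 2) * b%:~R : C).
      by rewrite hz; ring.
    by ring.
  by move/eqP; rewrite mulf_eq0 (subr_eq0 1) [1 == z]eq_sym (negbTE zN1) orbF.
have a2 : 3 * a ^+ 2 <= 4.
  have : `|l1 + l2| ^+ 2 <= 2 ^+ 2.
    rewrite ler_sqr ?nnegrE ?normr_ge0 ?ler0n //.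
    by rewrite (le_trans (ler_normD _ _)) // n1 n2.
  rewrite normCK hc hs -ab.
  have -> : (a%:~R + z * a%:~R) * (a%:~R + (1 - z) * a%:~R)
            = (3 * a ^+ 2)%:~R :> C.
    rewrite rmorphM rmorphXn /=.
    transitivity ((2 + (z - z ^+ 2)) * a%:~R ^+ 2 : C); first by ring.
    by rewrite hz; ring.
  have -> : 2 ^+ 2 = (4 : int)%:~R :> C by ring.
  by rewrite ler_int.
have -> : l1 + l2 = (1 + z) * a%:~R by rewrite hs -ab; ring.
have : [\/ a = 0, a = 1 | a = -1].
  have le1 : a <= 1 by nia.
  have geN1 : -1 <= a by nia.
  have : a = 0 \/ a = 1 \/ a = -1 by lia.
  by case=> [|[]] ->; [constructor 1|constructor 2|constructor 3].
by case=> ->; [constructor 1|constructor 2|constructor 3]; ring.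
Qed.

(** Pairs with a common product [p] and a common sum [s] are both the roots
    of [X ^ 2 - s X + p]. *)
Lemma eq_up_to_swap_sum (F : fieldType) (x1 x2 y1 y2 : F) :
  x1 * x2 = y1 * y2 -> x1 + x2 = y1 + y2 <-> eq_up_to_swap x1 x2 y1 y2.
Proof.
move=> hp; split=> [hs|]; last by case=> -[-> ->] //; rewrite addrC.
have : (x1 - y1) * (x1 - y2) = 0.
  transitivity (x1 ^+ 2 - x1 * (y1 + y2) + y1 * y2); first by ring.
  by rewrite -hs -hp; ring.
move/eqP; rewrite mulf_eq0 !subr_eq0 => /orP [] /eqP h; [left|right]; split=> //.
  by apply: (addrI x1); rewrite hs h.
by apply: (addrI x1); rewrite hs h addrC.
Qed.

(** * Values of the complex exponential at multiples of pi / 3 *)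

Lemma expiD (R : realType) (x y : R) : expi (x + y) = expi x * expi y.
Proof. by rewrite /expi cosD sinD; simpc; congr (_ +i* _); rewrite addrC. Qed.

Lemma expiNpi (R : realType) : expi (- pi) = -1 :> R[i].
Proof. by rewrite /expi cosN sinN cospi sinpi oppr0 -[RHS]/(- (1 +i* 0)); simpc. Qed.

Lemma expi_pi3 (R : realType) : expi (pi / 3) = (1 + sqrtm3 R) / 2.
Proof.
have p0 := pi_gt0 R.
have c0 : 0 < cos (pi / 3 : R) by apply: cos_gt0_pihalf; lra.
have s0 : 0 < sin (pi / 3 : R) by apply: sin_gt0_pi; lra.
have hcs := cos2Dsin2 (pi / 3 : R).
have h3 : cos (pi / 3 + pi / 3 + pi / 3 : R) = -1.
  by rewrite -cospi; congr cos; field.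
rewrite !(cosD, sinD) in h3.
rewrite /expi; move: (cos _) (sin _) c0 s0 hcs h3 => c s c0 s0 hcs h3.
have hs2 : s ^+ 2 = 1 - c ^+ 2 by rewrite -hcs; ring.
(* The triple angle formula gives 4 c ^ 3 - 3 c = -1; its left side plus 1
   factors as below. *)
have hc : c = 1 / 2.
  have : (c + 1) * (2 * c - 1) ^+ 2 = 0.
    transitivity (c * c * c - 3 * c * (1 - c ^+ 2) + 1); first by ring.
    by rewrite -hs2; lra.
  move/eqP; rewrite mulf_eq0 sqrf_eq0 => /orP [] /eqP; lra.
have hs : Num.sqrt 3 = 2 * s.
  rewrite -[RHS]ger0_norm; last by lra.
  by rewrite -sqrtr_sqr exprMn hs2 hc; congr Num.sqrt; field.
apply: (canRL (mulfK _)); first by rewrite pnatr_eq0.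
rewrite mulr_natr mulr2n /sqrtm3 hs hc -[1 in RHS]/(1 +i* 0); simpc.
by congr (_ +i* _); [field|ring].
Qed.

Lemma expi_pi3_sqr (R : realType) :
  expi (pi / 3) ^+ 2 = expi (pi / 3) - 1 :> R[i].
Proof.
have hs : sqrtm3 R ^+ 2 = -3.
  transitivity ((- 3 : R)%:C); last by rewrite rmorphN rmorph_nat.
  rewrite -[in RHS](@sqr_sqrtr R 3) ?ler0n // !expr2 /sqrtm3.
  by simpc.
rewrite expi_pi3.
transitivity ((1 + 2 * sqrtm3 R + sqrtm3 R ^+ 2) / 4); first by field.
by rewrite hs; field.
Qed.

(** * Classification *)

Theorem proposition19 (R : realType) (g : 'M[R[i]]_2) (r : nat)
  (hg : GL2_eisenstein g) (hr : has_order g r)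
  (hdet : \det g = expi (pi / 3 : R)) :
  [/\ r = 6%N,
      \tr g \in [:: 0; 3 / 2 + sqrtm3 R / 2; - (3 / 2 + sqrtm3 R / 2)]
    & forall l1 l2 : R[i], eigenvalues g l1 l2 ->
      [/\ \tr g = 0 <->
            eq_up_to_swap l1 l2 (expi (2 * pi / 3)) (expi (- (pi / 3))),
          \tr g = 3 / 2 + sqrtm3 R / 2 <->
            eq_up_to_swap l1 l2 (expi (pi / 3)) 1
        & \tr g = - (3 / 2) - sqrtm3 R / 2 <->
            eq_up_to_swap l1 l2 (expi (- (2 * pi / 3))) (- 1)]].
Proof.
case: hg => hO _; case: hr => r0 gr rmin.
set z := expi (pi / 3) in hdet *.
have zE : z = (1 + sqrtm3 R) / 2 := expi_pi3 R.
have hz : z ^+ 2 = z - 1 := expi_pi3_sqr R.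
have wE : 1 + z = 3 / 2 + sqrtm3 R / 2 by rewrite zE; field.
have e2 : expi (2 * pi / 3) = z ^+ 2 :> R[i].
  by rewrite expr2 -expiD; congr expi; field.
have eN1 : expi (- (pi / 3)) = - z ^+ 2 :> R[i].
  by rewrite -e2 -[RHS]mulN1r -expiNpi -expiD; congr expi; field.
have eN2 : expi (- (2 * pi / 3)) = - z :> R[i].
  by rewrite -[RHS]mulN1r -expiNpi -expiD; congr expi; field.
have hz3 := sixth_root_exp3 hz.
have trE : [\/ \tr g = 0, \tr g = 1 + z | \tr g = - (1 + z)].
  have [s hs] := closed_field_poly_normal (char_poly g).
  rewrite (monicP (char_poly_monic g)) scale1r in hs.
  have : size s = 2%N.
    by have := size_char_poly g; rewrite hs size_prod_XsubC => -[].
  case: s hs => [|l1 [|l2 [|]]] //= hs _.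
  rewrite big_cons big_seq1 in hs.
  have [ht hd] := eigenvalues_sum_prod hs.
  have n1 l : root (char_poly g) l -> `|l| = 1.
    rewrite -eigenvalue_root_char => /eigenvalue_exp1 /(_ gr) /(congr1 Num.norm).
    rewrite normrX normr1 => /eqP; rewrite pexpr_eq1 // => /eqP //.
  have [a0 [b0 E0]] := hO 0 0; have [a1 [b1 E1]] := hO 1 1.
  rewrite ht; apply: (@eisenstein_trace_of_unimodular _ z l1 l2 (a0 + a1) (b0 + b1)) => //.
  - by apply: n1; rewrite hs rootM root_XsubC eqxx.
  - by apply: n1; rewrite hs rootM !root_XsubC eqxx orbT.
  - by rewrite -hd.
  - rewrite -ht /mxtrace big_ord_recl big_ord1 E0.
    have -> : lift ord0 ord0 = 1 :> 'I_2 by apply: val_inj.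
    by rewrite E1 -zE !rmorphD /=; ring.
split.
- apply/eqP; rewrite eqn_leq; apply/andP; split.
    apply: rmin => //; apply: mx2_exp6; last by rewrite hdet.
    case: trE => ->; [by left|right|right]; rewrite hdet.
      by rewrite sqrrD hz; ring.
    by rewrite sqrrN sqrrD hz; ring.
  apply: dvdn_leq => //; rewrite (prim_order_dvd (sixth_root_primitive hz)).
  by rewrite -hdet -detX gr det1.
- by rewrite !inE -wE; case: trE => ->; rewrite eqxx ?orbT.
move=> l1 l2 /eigenvalues_sum_prod [-> hd]; rewrite hdet in hd.
rewrite e2 eN1 eN2.
split.
- rewrite -(subrr (z ^+ 2)); apply: eq_up_to_swap_sum.
  by rewrite -hd mulrN -expr2 -exprM exprS hz3 mulrN1 opprK.
- rewrite -wE [1 + z]addrC; apply: eq_up_to_swap_sum.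
  by rewrite -hd mulr1.
- have -> : - (3 / 2) - sqrtm3 R / 2 = - z + -1 by rewrite -opprD -wE; ring.
  by apply: eq_up_to_swap_sum; rewrite -hd mulrN1 opprK.
Qed.
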